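(* Let $\mathcal{L}$ be a bounded lattice. Then $\mathcal{L}$ is a local lattice if and only if for every $a\in\mathcal{L}$ with $a\neq 0$, the filter $T(\{a\})$ is an $\mathcal{M}$-filter of $\mathcal{L}$ for each maximal filter $\mathcal{M}$ of $\mathcal{L}$ containing $T(\{a\})$.
   Context: A lattice is a poset in which each pair $u,v$ has a greatest lower bound $u\wedge v$ and a least upper bound $u\vee v$; it is bounded if it has a least element $0$ and a greatest element $1$. A filter of $\mathcal{L}$ is a non-empty subset $F$ such that $u\wedge v\in F$ for all $u,v\in F$, and $u\in F$, $w\in\mathcal{L}$, $u\le w$ imply $w\in F$; it is proper if $F\neq\mathcal{L}$. A proper filter $F$ is maximal if whenever $H$ is a filter of $\mathcal{L}$ with $F\subsetneq H$, then $H=\mathcal{L}$. For $X\subseteq\mathcal{L}$, $T(X)$ denotes the filter generated by $X$, i.e. the intersection of all filters of $\mathcal{L}$ containing $X$. For proper filters $\mathcal{P},\mathcal{Q}$ of $\mathcal{L}$, $\mathcal{P}$ is a $\mathcal{Q}$-filter of $\mathcal{L}$ if for all $u,v\in\mathcal{L}$, $u\vee v\in\mathcal{P}$ and $u\notin\mathcal{Q}$ imply $v\in\mathcal{P}$. (Here this is used with $\mathcal{Q}=\mathcal{M}$.) $\mathcal{L}$ is called a local lattice if it has exactly one maximal filter containing all proper filters.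
   Formalization: The formal theorem also assumes 0 ≠ 1: the one-element lattice has no proper and hence no maximal filter, so it is not local, while the condition on elements a ≠ 0 holds vacuously, so the equivalence fails there; no other case is excluded. *)

(* Defs.v *)
From mathcomp Require Import all_boot all_order.
From mathcomp Require Import boolp classical_sets.

Set Implicit Arguments.
Unset Strict Implicit.
Unset Printing Implicit Defensive.

Local Open Scope classical_set_scope.
Local Open Scope order_scope.

Definition lattice_filter d (L : latticeType d) (F : set L) : Prop :=
  [/\ F !=set0,
      (forall u v : L, F u -> F v -> F (Order.meet u v)) &
      (forall u w : L, F u -> u <= w -> F w)].

Definition proper_filter d (L : latticeType d) (F : set L) : Prop :=
  lattice_filter F /\ F <> setT.

Definition maximal_filter d (L : latticeType d) (F : set L) : Prop :=
  proper_filter F /\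
  (forall H : set L, lattice_filter H -> F `<` H -> H = setT).

Definition generated_filter d (L : latticeType d) (X : set L) : set L :=
  smallest (@lattice_filter d L) X.

(* [relative_filter Q P]: "P is a Q-filter"; the reference filter Q comes first. *)
Definition relative_filter d (L : latticeType d) (Q P : set L) : Prop :=
  [/\ proper_filter P,
      proper_filter Q &
      (forall u v : L, P (Order.join u v) -> ~ Q u -> P v)].

Definition local_lattice d (L : latticeType d) : Prop :=
  exists! M : set L,
    maximal_filter M /\ (forall F : set L, proper_filter F -> F `<=` M).

(* Main.v *)
Require Import Defs.
From mathcomp Require Import all_boot all_order.
From mathcomp Require Import boolp classical_sets.

(** Both conditions say that two nonzero elements never have meet [\bot], that is,
    that the set of nonzero elements is a filter.

    If the lattice is local, its greatest proper filter [M] contains the principal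
    filter of every nonzero element, and every maximal filter equals [M]. So
    [u \notin M] forces [u = \bot], and then [u \/ v] is just [v]: the
    [M]-filter condition is trivial.

    Conversely, suppose [u /\ v = \bot] with [u] and [v] nonzero. By Zorn's lemma
    ([maximal_filter_exists]) some maximal filter [M] contains [u], hence also
    the principal filter of [a = v \/ u], while [v] is not in [M] because
    [u /\ v = \bot]. Applying the [M]-filter condition to [v \/ u] gives
    [a <= u], so [v <= u] and [v = u /\ v = \bot], a contradiction.
    The nonzero elements thus form a filter, which is clearly the greatest proper
    one ([local_lattice_of_meet_neq0]). *)

Set Implicit Arguments.
Unset Strict Implicit.
Unset Printing Implicit Defensive.

Import Order.TTheory.

Local Open Scope classical_set_scope.
Local Open Scope order_scope.

Lemma lattice_filter_upset d (L : latticeType d) (a : L) :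
  lattice_filter [set x | a <= x].
Proof.
split; first by exists a => /=.
- by move=> u v /= au av; rewrite lexI au av.
- by move=> u w /= au; apply: le_trans.
Qed.

Lemma generated_filter1 d (L : latticeType d) (a : L) :
  generated_filter [set a] = [set x | a <= x].
Proof.
apply/seteqP; split=> x /=.
- move/(_ [set x | a <= x]); apply; split; first exact: lattice_filter_upset.
  by move=> y ->; exact: lexx.
- by move=> ax F [[_ _ Fup] aF]; apply: Fup ax; exact: aF.
Qed.

Lemma lattice_filter_setTP d (L : bLatticeType d) (F : set L) :
  lattice_filter F -> F = setT <-> F \bot.
Proof.
move=> [_ _ Fup]; split=> [->//|F0].
by apply/seteqP; split=> // x _; apply: Fup F0 (le0x x).
Qed.

Lemma proper_filter_upset d (L : bLatticeType d) (a : L) :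
  a <> \bot -> proper_filter [set x | a <= x].
Proof.
move=> a0; have Fa := lattice_filter_upset a; split=> //.
by move/(lattice_filter_setTP Fa) => /=; rewrite lex0 => /eqP.
Qed.

(** Zorn's lemma, applied to the filters that contain [a] and avoid [\bot]; such
    a filter is maximal among all proper filters because any larger filter
    still contains [a]. *)
Lemma maximal_filter_exists d (L : bLatticeType d) (a : L) :
  a <> \bot -> exists2 M : set L, maximal_filter M & M a.
Proof.
move=> a0.
(* The empty chain has union [set0], so the empty set is admitted here; the last
   clause still forces every nonempty member to contain [a]. *)
pose P (X : set L) := [/\ forall u v, X u -> X v -> X (u `&` v)%O,
  forall u w, X u -> u <= w -> X w, ~ X \bot & forall x, X x -> X a].
have [F FP Ftot|M [[Mmeet Mup M0 Ma'] Mmax]] := @Zorn_bigcup L P.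
  split.
  - move=> u v [X FX Xu] [Y FY Yv].
    have [XY|YX] := Ftot X Y FX FY.
    + by exists Y => //; have [Ymeet _ _ _] := FP _ FY; apply: Ymeet => //; exact: XY.
    + by exists X => //; have [Xmeet _ _ _] := FP _ FX; apply: Xmeet => //; exact: YX.
  - move=> u w [X FX Xu] uw; exists X => //.
    by have [_ Xup _ _] := FP _ FX; apply: Xup uw.
  - by move=> [X FX X0]; have [_ _ + _] := FP _ FX.
  - by move=> x [X FX Xx]; exists X => //; have [_ _ _] := FP _ FX; apply; exact: Xx.
have Ma : M a.
  apply: contrapT => nMa; apply: (Mmax [set x | a <= x]).
    by split=> [x /Ma' //|/(_ a (lexx a))].
  have [[_ Umeet Uup] _] := proper_filter_upset a0.
  by split=> //=; rewrite lex0 => /eqP.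
have MF : lattice_filter M by split=> //; exists a.
exists M => //; split; first by split=> // /(lattice_filter_setTP MF).
move=> H HF MH; apply/(lattice_filter_setTP HF); apply: contrapT => H0.
apply: (Mmax H) => //; have [_ Hmeet Hup] := HF; split=> // _ _.
by case: MH => + _; exact.
Qed.

Lemma local_lattice_of_meet_neq0 d (L : tbLatticeType d) :
  (\bot : L) <> \top ->
  (forall u v : L, u <> \bot -> v <> \bot -> (u `&` v)%O <> \bot) ->
  local_lattice L.
Proof.
move=> nontrivial meet_neq0; pose M := [set x : L | x <> \bot].
have MF : lattice_filter M.
  split; [by exists \top => /= /esym | exact: meet_neq0 |].
  by move=> u w /= u0 uw w0; apply: u0; apply/eqP; rewrite -lex0 -w0.
have Mproper : proper_filter M by split=> // /(lattice_filter_setTP MF); exact.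
have Mmax (F : set L) : proper_filter F -> F `<=` M.
  move=> [FF FT] x Fx x0; apply: FT; apply/(lattice_filter_setTP FF).
  by rewrite -x0.
exists M; split.
  split=> //; split=> // H HF [MH HM]; apply: contrapT => HT.
  by apply: HM; exact: Mmax.
move=> N [[Nproper _] Nmax]; apply/seteqP; split; first exact: Nmax.
exact: Mmax.
Qed.

Theorem theorem3p7 (d : Order.disp_t) (L : tbLatticeType d)
    (nontrivial : (\bot : L) <> (\top : L)) :
  local_lattice L <->
  (forall a : L, a <> \bot ->
   forall M : set L, maximal_filter M -> generated_filter [set a] `<=` M ->
     relative_filter M (generated_filter [set a])).
Proof.
split=> [[M [[[Mproper _] Mgreatest] _]] a a0 N [Nproper Nmax]|rel].
  rewrite generated_filter1 => _; split=> //; first exact: proper_filter_upset.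
  have MN : M `<=` N.
    apply: contrapT => MN; case: Mproper => MF; apply; apply: Nmax => //.
    by split; [exact: Mgreatest | exact: MN].
  move=> u v /= auv Nu; suff u0 : u = \bot by rewrite u0 join0x in auv.
  apply: contrapT => u0; apply: Nu; apply: MN.
  by apply: (Mgreatest _ (proper_filter_upset u0)) => /=.
apply: local_lattice_of_meet_neq0 => // u v u0 v0 uv0.
have [M Mmax Mu] := maximal_filter_exists u0.
have [[MF MT] _] := Mmax; have [_ Mmeet Mup] := MF.
have nMv : ~ M v.
  by move=> Mv; apply: MT; apply/(lattice_filter_setTP MF); rewrite -uv0; exact: Mmeet.
have vu_neq0 : (v `|` u)%O <> \bot.
  by move/eqP; rewrite join_eq0 => /andP[/eqP].
have vuM : generated_filter [set (v `|` u)%O] `<=` M.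
  by rewrite generated_filter1 => x /=; apply: (Mup); apply: Mup Mu (leUr _ _).
have [_ _] := rel _ vu_neq0 _ Mmax vuM; rewrite generated_filter1 => relM.
have /= := relM v u (lexx _) nMv; rewrite leUx => /andP[vu _].
by apply: v0; rewrite -uv0; apply/esym/meet_idPr.
Qed.
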